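(* Let $\mathbb{K}_2^n\subset\mathbb{R}^n$ be the second-order cone, let $c_1,c_2\in\mathbb{R}^n$ and $c_{1,0},c_{2,0}\in\{0,\pm1\}$ with $c_{1,0}\ge c_{2,0}$, and let $C_i:=\{x\in\mathbb{K}_2^n:\ c_i^\top x\ge c_{i,0}\}$ for $i\in\{1,2\}$. Suppose that $C_1\not\subseteq C_2$, $C_2\not\subseteq C_1$, $C_i\cap\operatorname{int}\mathbb{K}_2^n\ne\emptyset$ for $i\in\{1,2\}$, and $c_1-c_2\notin\pm\mathbb{K}_2^n$. Set $\mathcal{N}:=\|\tilde c_1-\tilde c_2\|_2^2-(c_{1,n}-c_{2,n})^2$. Then the inequality $$2c_{2,0}-(c_1+c_2)^\top x\ \le\ \sqrt{\big((c_1-c_2)^\top x\big)^2+\mathcal{N}\big(x_n^2-\|\tilde x\|_2^2\big)}\qquad(\ast)$$ is valid for $\overline{\mathrm{conv}}(C_1\cup C_2)$. Furthermore, $$\overline{\mathrm{conv}}(C_1\cup C_2)=\{x\in\mathbb{K}_2^n:\ x\text{ satisfies }(\ast)\}$$ when, in addition, at least one of the following holds: (i) $c_1\in\mathbb{K}_2^n$ or $c_2\in\mathbb{K}_2^n$; or (ii) $c_{1,0}=c_{2,0}\in\{\pm1\}$ and the undominated valid linear inequalities for $\overline{\mathrm{conv}}(C_1\cup C_2)$ that are tight on both $C_1$ and $C_2$ are sufficient (together with the cone constraint $x\in\mathbb{K}_2^n$) to describe $\overline{\mathrm{conv}}(C_1\cup C_2)$.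
   Context: For $x\in\mathbb{R}^n$, $\tilde x:=(x_1;\dots;x_{n-1})$, and $c_{i,n}$ is the $n$-th entry of $c_i$, $\tilde c_i$ its first $n-1$ entries. $\mathbb{K}_2^n:=\{x\in\mathbb{R}^n:\|\tilde x\|_2\le x_n\}$, which is self-dual. $\overline{\mathrm{conv}}$ is the closed convex hull; $v\notin\pm\mathbb{K}$ means $v\notin\mathbb{K}$ and $v\notin-\mathbb{K}$. A linear inequality $\mu^\top x\ge\mu_0$ is valid for a set if it holds at all its points. It is tight on a set $S$ if $\inf\{\mu^\top x:x\in S\}=\mu_0$. A valid linear inequality $\mu^\top x\ge\mu_0$ for $\overline{\mathrm{conv}}(C_1\cup C_2)$, with $(\mu,\mu_0)\neq(0,0)$, is undominated if there is no valid linear inequality $\nu^\top x\ge\nu_0$ for $\overline{\mathrm{conv}}(C_1\cup C_2)$ with $(\mu-\nu,\mu_0-\nu_0)\in\big(\mathbb{K}_2^n\times(-\mathbb{R}_+)\big)\setminus\{(0,0)\}$. A family of valid linear inequalities is sufficient to describe a closed convex set $X\subseteq\mathbb{K}_2^n$ together with the cone constraint if $X$ equals the set of all $x\in\mathbb{K}_2^n$ satisfying every inequality of the family. *)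

(* Defs.v *)
From HB Require Import structures.
From mathcomp Require Import all_boot all_order all_algebra.
From mathcomp Require Import all_classical all_reals all_analysis.

Set Implicit Arguments.
Unset Strict Implicit.
Unset Printing Implicit Defensive.

Import Order.TTheory GRing.Theory Num.Theory.
Import numFieldNormedType.Exports.

Local Open Scope classical_set_scope.
Local Open Scope ring_scope.

Definition dotv (R : realType) (m : nat) (u v : 'cV[R]_m) : R := (u^T *m v) 0 0.

(* The norm [`|x|] of the library on matrices is the max norm. *)
Definition norm2 (R : realType) (m : nat) (x : 'cV[R]_m) : R :=
  Num.sqrt (\sum_(i < m) x i 0 ^+ 2).

(* Vectors live in dimension [n.+1], so that the last entry exists. *)
Definition lastc (R : realType) (n : nat) (x : 'cV[R]_n.+1) : R := x ord_max 0.

Definition initv (R : realType) (n : nat) (x : 'cV[R]_n.+1) : 'cV[R]_n :=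
  row' ord_max x.

Definition soc (R : realType) (n : nat) : set 'cV[R]_n.+1 :=
  [set x | norm2 (initv x) <= lastc x].

Definition cut_soc (R : realType) (n : nat) (c : 'cV[R]_n.+1) (c0 : R) :
    set 'cV[R]_n.+1 :=
  [set x | soc x /\ c0 <= dotv c x].

Definition convex_hull (R : realType) (m : nat) (A : set 'cV[R]_m) :
    set 'cV[R]_m :=
  smallest (@convex_set R 'cV[R]_m) A.

Definition closed_convex_hull (R : realType) (m : nat) (A : set 'cV[R]_m) :
    set 'cV[R]_m :=
  closure (convex_hull A).

(* A pair [(mu, mu0)] stands for the linear inequality [mu^T x >= mu0]. *)
Definition valid_ineq (R : realType) (m : nat) (S : set 'cV[R]_m)
    (p : 'cV[R]_m * R) : Prop :=
  forall x, S x -> p.2 <= dotv p.1 x.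

(* The infimum is taken in the extended reals: the real-valued [inf] has a junk
   value on empty or unbounded sets. *)
Definition tight_on (R : realType) (m : nat) (S : set 'cV[R]_m)
    (p : 'cV[R]_m * R) : Prop :=
  ereal_inf [set (dotv p.1 x)%:E | x in S] = p.2%:E.

Definition undominated (R : realType) (n : nat) (S : set 'cV[R]_n.+1)
    (p : 'cV[R]_n.+1 * R) : Prop :=
  [/\ valid_ineq S p,
      p <> (0, 0) &
      ~ exists2 q : 'cV[R]_n.+1 * R, valid_ineq S q &
          ((@soc R n `*` [set r | r <= 0]) `\` [set (0, 0)])
            (p.1 - q.1, p.2 - q.2)].

Definition sufficient (R : realType) (n : nat) (F : set ('cV[R]_n.+1 * R))
    (X : set 'cV[R]_n.+1) : Prop :=
  X = [set x | soc x /\ forall p, F p -> p.2 <= dotv p.1 x].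

Definition calN (R : realType) (n : nat) (c1 c2 : 'cV[R]_n.+1) : R :=
  norm2 (initv c1 - initv c2) ^+ 2 - (lastc c1 - lastc c2) ^+ 2.

(* On the cone, when [0 <= calN c1 c2], the radicand is nonnegative, so the
   junk value of [Num.sqrt] plays no role. *)
Definition disj_ineq (R : realType) (n : nat) (c1 c2 : 'cV[R]_n.+1) (c20 : R)
    (x : 'cV[R]_n.+1) : Prop :=
  2 * c20 - dotv (c1 + c2) x <=
  Num.sqrt (dotv (c1 - c2) x ^+ 2 +
            calN c1 c2 * (lastc x ^+ 2 - norm2 (initv x) ^+ 2)).

(* Main.v *)
Require Import Defs.
From HB Require Import structures.
From mathcomp Require Import all_boot all_order all_algebra.
From mathcomp Require Import all_classical all_reals all_analysis.
From mathcomp Require Import ring lra.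
Import Order.TTheory GRing.Theory Num.Theory.
Import numFieldNormedType.Exports.
Local Open Scope classical_set_scope.
Local Open Scope ring_scope.

(** Write K for the cone, d = c1 - c2 and Q(x) = x_n^2 - |x~|^2. The proof rests
    on a description of the inequality by a splitting: a point x of K satisfies
    it if and only if x = y + w for some y, w in K with c2_0 <= c1.y + c2.w
    ([disj_ineqE]). Indeed, for x in K the square root is the largest value of
    d.(y - w) over all splittings x = y + w in K, and
      2 (c1.y + c2.w) = (c1 + c2).x + d.(y - w).
    The upper bound comes from the fact that the Lorentz reflection in the
    spacelike vector d maps K to K ([spacelike_reflection_ge0]); the maximum is
    attained where y and w are both null vectors in the plane spanned by x and
    the reflected copy of d ([null_splitting]).

    The set of splittable points is visibly convex and contains C1 (take w = 0)
    and C2 (take y = 0). The inequality cuts out a closed set, so it is valid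
    for the closed convex hull.

    For the converse let x = y + w be a splitting.
    - If c1 lies in K, properness of the cut C1 forces c1_0 = 1, and C1 is stable
      under adding elements of K. When c2_0 <= 0 the origin is in C2 and the hull
      is all of K ([hull_recession]). When c2_0 = 1, put l = c1.y: for 0 < l < 1
      the point x is the convex combination of y / l in C1 and w / (1 - l) in C2,
      and the degenerate cases are limits or trivial ([split_in_hull]). If c2
      lies in K, then c1_0 = c2_0 = 1 and the roles are exchanged.
    - Otherwise it is enough to check an inequality mu.x >= mu0 that is valid and
      tight on both sets. Lagrange duality ([lagrange_duality]) gives mu - b_i c_i
      in K with b_i >= 0, and tightness forces mu0 = b_i c_i0; since c1_0 = c2_0
      is nonzero, b_1 = b_2 = b. Hence
        mu.x = mu.y + mu.w >= b (c1.y + c2.w) >= b c2_0 = mu0. *)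

Section Proof.
Set Implicit Arguments.
Unset Strict Implicit.
Unset Printing Implicit Defensive.

(** * The Euclidean product *)

Section EuclideanDot.
Variables (R : realType) (m : nat).
Implicit Types (u v w : 'cV[R]_m) (a : R).

Lemma dotvE u v : dotv u v = \sum_i u i 0 * v i 0.
Proof. by rewrite /dotv mxE; apply: eq_bigr => i _; rewrite mxE. Qed.

Lemma dotvC u v : dotv u v = dotv v u.
Proof. by rewrite !dotvE; apply: eq_bigr => i _; rewrite mulrC. Qed.

Lemma dotvDr u v w : dotv u (v + w) = dotv u v + dotv u w.
Proof. by rewrite /dotv mulmxDr mxE. Qed.

Lemma dotvZr a u v : dotv u (a *: v) = a * dotv u v.
Proof. by rewrite /dotv -scalemxAr mxE. Qed.

Lemma dotvNr u v : dotv u (- v) = - dotv u v.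
Proof. by rewrite -scaleN1r dotvZr mulN1r. Qed.

Lemma dotvDl u v w : dotv (v + w) u = dotv v u + dotv w u.
Proof. by rewrite dotvC dotvDr !(dotvC u). Qed.

Lemma dotvZl a u v : dotv (a *: v) u = a * dotv v u.
Proof. by rewrite dotvC dotvZr dotvC. Qed.

Lemma dotvNl u v : dotv (- v) u = - dotv v u.
Proof. by rewrite dotvC dotvNr dotvC. Qed.

Lemma dotv0 u : dotv u 0 = 0.
Proof. by rewrite /dotv mulmx0 mxE. Qed.

Lemma dotv0l u : dotv 0 u = 0.
Proof. by rewrite dotvC dotv0. Qed.

Definition dotv_lin := (dotvDl, dotvDr, dotvZl, dotvZr, dotvNl, dotvNr).

Lemma dotvv_ge0 u : 0 <= dotv u u.
Proof. by rewrite dotvE sumr_ge0// => i _; rewrite -expr2 sqr_ge0. Qed.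

Lemma sqr_norm2 u : norm2 u ^+ 2 = dotv u u.
Proof.
rewrite /norm2 sqr_sqrtr; last by rewrite sumr_ge0// => i _; rewrite sqr_ge0.
by rewrite dotvE; apply: eq_bigr => i _; rewrite expr2.
Qed.

Lemma norm2_ge0 u : 0 <= norm2 u.
Proof. exact: sqrtr_ge0. Qed.

Lemma dotvv_gt0 u : u != 0 -> 0 < dotv u u.
Proof.
move=> u0; rewrite lt_neqAle dotvv_ge0 andbT eq_sym; apply: contra_neq u0.
rewrite dotvE => /psumr_eq0P H; apply/matrixP => i j.
rewrite ord1 mxE; apply/eqP; rewrite -sqrf_eq0 expr2; apply/eqP.
by apply: H => // k _; rewrite -expr2 sqr_ge0.
Qed.

Lemma cauchy_schwarz u v : dotv u v ^+ 2 <= dotv u u * dotv v v.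
Proof.
have [->|v0] := eqVneq v 0; first by rewrite !dotv0 expr0n mulr0.
have vv := dotvv_gt0 v0.
have := dotvv_ge0 (dotv v v *: u - dotv u v *: v).
rewrite !dotv_lin (dotvC v u) => H.
rewrite -subr_ge0 -(pmulr_rge0 _ vv); apply: le_trans H _.
by rewrite le_eqVlt; apply/orP; left; apply/eqP; ring.
Qed.

Lemma dotv_norm2 u v : `|dotv u v| <= norm2 u * norm2 v.
Proof.
rewrite -(@ler_pXn2r _ 2) ?nnegrE ?normr_ge0 ?mulr_ge0 ?norm2_ge0//.
by rewrite real_normK ?num_real// exprMn !sqr_norm2 cauchy_schwarz.
Qed.

End EuclideanDot.

(** * The Lorentz form and the second-order cone *)

Section Lorentz.
Variables (R : realType) (n : nat).
Implicit Types (x y z c d : 'cV[R]_n.+1) (a b : R).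

Definition lorentz x y := lastc x * lastc y - dotv (initv x) (initv y).

(** Time-preserving reflection: it turns the Euclidean pairing with [c] into the
    Lorentz pairing with [flip c], so that both can be treated alike. *)
Definition flip x : 'cV[R]_n.+1 := 2 * lastc x *: delta_mx ord_max 0 - x.

Lemma lastcD x y : lastc (x + y) = lastc x + lastc y.
Proof. by rewrite /lastc mxE. Qed.

Lemma lastcZ a x : lastc (a *: x) = a * lastc x.
Proof. by rewrite /lastc mxE. Qed.

Lemma lastcN x : lastc (- x) = - lastc x.
Proof. by rewrite /lastc mxE. Qed.

Lemma initvD x y : initv (x + y) = initv x + initv y.
Proof. by apply/matrixP => i j; rewrite !mxE. Qed.

Lemma initvZ a x : initv (a *: x) = a *: initv x.
Proof. by apply/matrixP => i j; rewrite !mxE. Qed.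

Lemma initvN x : initv (- x) = - initv x.
Proof. by apply/matrixP => i j; rewrite !mxE. Qed.

Lemma lastc_axis : lastc (delta_mx ord_max 0 : 'cV[R]_n.+1) = 1.
Proof. by rewrite /lastc mxE !eqxx. Qed.

Lemma initv_axis : initv (delta_mx ord_max 0 : 'cV[R]_n.+1) = 0.
Proof.
by apply/matrixP => i j; rewrite !mxE eq_sym (negbTE (neq_lift _ _)).
Qed.

Lemma lastc_flip x : lastc (flip x) = lastc x.
Proof. by rewrite /flip lastcD lastcZ lastcN lastc_axis; ring. Qed.

Lemma initv_flip x : initv (flip x) = - initv x.
Proof. by rewrite /flip initvD initvZ initvN initv_axis scaler0 add0r. Qed.

Lemma dotv_split x y : dotv x y = lastc x * lastc y + dotv (initv x) (initv y).
Proof.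
rewrite !dotvE big_ord_recr /= addrC; congr (_ + _).
apply: eq_bigr => i _; rewrite !mxE.
by have -> : lift ord_max i = widen_ord (leqnSn n) i
  by apply/val_inj; rewrite /= /bump leqNgt ltn_ord.
Qed.

Lemma dotv_flip d x : dotv d x = lorentz (flip d) x.
Proof. by rewrite dotv_split /lorentz lastc_flip initv_flip dotvNl opprK. Qed.

Lemma lorentzC x y : lorentz x y = lorentz y x.
Proof. by rewrite /lorentz mulrC dotvC. Qed.

Lemma lorentzDr x y z : lorentz x (y + z) = lorentz x y + lorentz x z.
Proof. by rewrite /lorentz lastcD initvD dotvDr; ring. Qed.

Lemma lorentzZr a x y : lorentz x (a *: y) = a * lorentz x y.
Proof. by rewrite /lorentz lastcZ initvZ dotvZr; ring. Qed.

Lemma lorentzNr x y : lorentz x (- y) = - lorentz x y.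
Proof. by rewrite -scaleN1r lorentzZr mulN1r. Qed.

Lemma lorentzDl x y z : lorentz (y + z) x = lorentz y x + lorentz z x.
Proof. by rewrite lorentzC lorentzDr !(lorentzC x). Qed.

Lemma lorentzZl a x y : lorentz (a *: y) x = a * lorentz y x.
Proof. by rewrite lorentzC lorentzZr lorentzC. Qed.

Lemma lorentzNl x y : lorentz (- y) x = - lorentz y x.
Proof. by rewrite lorentzC lorentzNr lorentzC. Qed.

Definition lorentz_lin :=
  (lorentzDl, lorentzDr, lorentzZl, lorentzZr, lorentzNl, lorentzNr).

Lemma calN_lorentz c1 c2 : calN c1 c2 = - lorentz (flip (c1 - c2)) (flip (c1 - c2)).
Proof.
rewrite /calN /lorentz lastc_flip initv_flip sqr_norm2 initvD lastcD initvN lastcN.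
by rewrite !dotv_lin; ring.
Qed.

(** The cone is the set of future-directed causal vectors; this replaces the
    square root in its definition by a quadratic form. *)
Lemma socP x : soc x <-> 0 <= lastc x /\ 0 <= lorentz x x.
Proof.
rewrite /soc/= /lorentz -sqr_norm2 -expr2 subr_ge0; split=> [sx|[x0 H]].
  have x0 := le_trans (norm2_ge0 _) sx; split=> //.
  by rewrite lerXn2r ?nnegrE ?norm2_ge0.
by move: H; rewrite ler_pXn2r ?nnegrE ?norm2_ge0.
Qed.

Lemma soc0 : soc (0 : 'cV[R]_n.+1).
Proof. by rewrite -(scale0r 0); apply/socP; rewrite lastcZ lorentzZl !mul0r. Qed.

Lemma soc_lorentz x y : soc x -> soc y -> 0 <= lorentz x y.
Proof.
rewrite /soc /lorentz /= => sx sy; rewrite subr_ge0.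
apply: le_trans (ler_norm _) _; apply: le_trans (dotv_norm2 _ _) _.
by rewrite ler_pM ?norm2_ge0.
Qed.

Lemma soc_flip x : soc x -> soc (flip x).
Proof.
move=> /socP[h0 h1]; apply/socP.
by rewrite /lorentz lastc_flip initv_flip !dotv_lin opprK.
Qed.

Lemma soc_dotv x y : soc x -> soc y -> 0 <= dotv x y.
Proof. by move=> sx sy; rewrite dotv_flip soc_lorentz//; exact: soc_flip. Qed.

Lemma soc_scale a x : 0 <= a -> soc x -> soc (a *: x).
Proof.
move=> a0 /socP[h0 h1]; apply/socP; rewrite lastcZ !lorentz_lin.
by rewrite !mulr_ge0.
Qed.

Lemma soc_add x y : soc x -> soc y -> soc (x + y).
Proof.
move=> sx sy; have xy := soc_lorentz sx sy.
have [x0 qx] := (socP x).1 sx; have [y0 qy] := (socP y).1 sy; apply/socP.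
by rewrite lastcD !lorentz_lin (lorentzC y x); split; lra.
Qed.

(** The test vector is the null vector whose spatial part is opposite to that of
    [z]. When that spatial part is zero this vector carries no information, so
    the time axis is tested as well. *)
Lemma soc_self_dual z : (forall x, soc x -> 0 <= dotv z x) -> soc z.
Proof.
move=> H; pose e : 'cV[R]_n.+1 := delta_mx ord_max 0.
have z0 : 0 <= lastc z.
  have := H e; rewrite dotv_split lastc_axis initv_axis dotv0 mulr1 addr0; apply.
  by apply/socP; rewrite /lorentz lastc_axis initv_axis dotv0 mulr1 subr0.
have := H (flip z + (norm2 (initv z) - lastc z) *: e).
rewrite /soc /= initvD initvZ initv_axis scaler0 addr0 initv_flip.
rewrite lastcD lastcZ lastc_axis lastc_flip mulr1 [lastc z + _]addrC subrK.
rewrite dotv_split initvD initvZ initv_axis scaler0 addr0 initv_flip.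
rewrite lastcD lastcZ lastc_axis lastc_flip mulr1 [lastc z + _]addrC subrK.
rewrite dotvNr -sqr_norm2.
have -> : norm2 (- initv z) = norm2 (initv z).
  by rewrite /norm2; congr (Num.sqrt _); apply: eq_bigr => i _; rewrite !mxE sqrrN.
move=> /(_ (lexx _)) H1.
have [//|lt_z] := leP (norm2 (initv z)) (lastc z).
by nra.
Qed.

Lemma soc_or_opp z : 0 <= lorentz z z -> soc z \/ soc (- z).
Proof.
move=> qz; have [z0|z0] := leP 0 (lastc z); [left|right]; apply/socP => //.
by rewrite lastcN !lorentz_lin opprK oppr_ge0 (ltW z0).
Qed.

(** A causal vector is future-directed or past-directed, and its pairing with a
    single future-directed vector decides which. This avoids computing last
    coordinates. *)
Lemma soc_of_lorentz_gt0 x z : soc x -> 0 <= lorentz z z -> 0 < lorentz z x -> soc z.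
Proof.
move=> sx qz zx; have [//|/soc_lorentz/(_ sx)] := soc_or_opp qz.
by rewrite lorentzNl oppr_ge0 leNgt zx.
Qed.

End Lorentz.

(** * The disjunctive inequality as a splitting condition *)

Section Disj.
Variables (R : realType) (n : nat).
Implicit Types (x y z c d : 'cV[R]_n.+1) (a b : R).

Lemma calN_gt0 c1 c2 : ~ soc (c1 - c2) ->
  ~ ((fun x => - x) @` @soc R n) (c1 - c2) -> 0 < calN c1 c2.
Proof.
move=> hpos hneg; rewrite calN_lorentz -dotv_flip dotv_split initv_flip lastc_flip.
rewrite dotvNr -[_ - _]/(lorentz _ _) oppr_gt0 ltNge; apply/negP => /soc_or_opp[//|h].
by apply: hneg; exists (- (c1 - c2)); rewrite ?opprK.
Qed.

(** Up to the factor [- lorentz d d], the vector [z] of the proof is the image of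
    [y] under the Lorentz reflection in [d]. Such a reflection preserves the form,
    and it preserves the time direction because [d] is spacelike; so [z] is in the
    cone and pairs nonnegatively with [w]. *)
Lemma spacelike_reflection_ge0 d y w : lorentz d d < 0 -> soc y -> soc w ->
  0 <= 2 * (lorentz d y * lorentz d w) - lorentz d d * lorentz y w.
Proof.
move=> dd sy sw; pose z := - lorentz d d *: y + (2 * lorentz d y) *: d.
have -> : 2 * (lorentz d y * lorentz d w) - lorentz d d * lorentz y w = lorentz z w.
  by rewrite /z !lorentz_lin; ring.
apply: soc_lorentz => //; have [_ qy] := (socP y).1 sy.
have [dy0|dy0] := eqVneq (lorentz d y) 0.
  by rewrite /z dy0 mulr0 scale0r addr0; apply: soc_scale => //; lra.
apply: (soc_of_lorentz_gt0 sy).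
  have -> : lorentz z z = lorentz d d ^+ 2 * lorentz y y.
    by rewrite /z !lorentz_lin (lorentzC y d); ring.
  by rewrite mulr_ge0// sqr_ge0.
have -> : lorentz z y = - lorentz d d * lorentz y y + 2 * lorentz d y ^+ 2.
  by rewrite /z !lorentz_lin; ring.
have h1 : 0 < lorentz d y ^+ 2 by rewrite exprn_even_gt0.
have h2 : 0 <= - lorentz d d * lorentz y y by rewrite mulr_ge0//; lra.
lra.
Qed.

(** The maximum of [lorentz d (y - w)] over the splittings [x = y + w] is attained
    at null vectors: with [f] the square root, the identity
    [f ^+ 2 - lorentz d x ^+ 2 = - lorentz d d * lorentz x x] makes both
      y = ((f + d.x) x - Q(x) d) / 2f   and   w = ((f - d.x) x + Q(x) d) / 2f
    null, where d.x and Q are Lorentz products. *)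
Lemma null_splitting d x : lorentz d d < 0 -> soc x ->
  exists y, [/\ soc y, soc (x - y) &
    2 * lorentz d y =
      lorentz d x + Num.sqrt (lorentz d x ^+ 2 - lorentz d d * lorentz x x)].
Proof.
move=> dd sx; set f := Num.sqrt _; have [_ qx] := (socP x).1 sx.
have f0 : 0 <= f by exact: sqrtr_ge0.
have ff : f ^+ 2 = lorentz d x ^+ 2 - lorentz d d * lorentz x x.
  by rewrite sqr_sqrtr// addr_ge0 ?sqr_ge0// -mulNr mulr_ge0//; lra.
have qq : lorentz d d * lorentz x x = lorentz d x ^+ 2 - f ^+ 2 by rewrite ff; ring.
have dxf : `|lorentz d x| <= f.
  rewrite -(@ler_pXn2r _ 2) ?nnegrE// real_normK ?num_real// ff.
  by rewrite lerDl -mulNr mulr_ge0//; lra.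
have [lo hi] : - f <= lorentz d x /\ lorentz d x <= f.
  by move: dxf; rewrite ler_norml => /andP[].
have [f00|fn0] := eqVneq f 0.
  (* Here [x] is null and orthogonal to [d]: the formulas degenerate. *)
  exists 0; rewrite subr0; split => //; first exact: soc0.
  by rewrite -(scale0r 0) lorentzZr f00; lra.
have fp : 0 < f by rewrite lt_neqAle eq_sym fn0.
pose y := (2 * f)^-1 *: ((f + lorentz d x) *: x - lorentz x x *: d).
pose w := (2 * f)^-1 *: ((f - lorentz d x) *: x + lorentz x x *: d).
have xy : x - y = w.
  apply/eqP; rewrite subr_eq /y /w -scalerDr addrACA subrr addr0 addrC.
  by rewrite -scalerDl scalerA -[x in x == _]scale1r; apply/eqP; congr (_ *: _); field.
have i0 : 0 <= (2 * f)^-1 by rewrite invr_ge0 mulr_ge0.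
exists y; rewrite xy; split.
- have [q0|qn0] := eqVneq (lorentz x x) 0.
    (* For a null [x] the pairing with [x] does not tell the time direction,
       but [y] is then a nonnegative multiple of [x]. *)
    rewrite /y q0 scale0r subr0; do 2 apply: soc_scale => //; lra.
  apply: (soc_of_lorentz_gt0 sx).
    have -> : lorentz y y = (2 * f)^-1 ^+ 2 * lorentz x x * ((f + lorentz d x) ^+ 2 -
        2 * (f + lorentz d x) * lorentz d x + lorentz d d * lorentz x x).
      by rewrite /y !lorentz_lin (lorentzC x d); ring.
    rewrite qq; rewrite (_ : _ * _ = 0) //; ring.
  have -> : lorentz y x = lorentz x x / 2 by rewrite /y !lorentz_lin; field.
  by rewrite divr_gt0// lt_neqAle eq_sym qn0.
- have [q0|qn0] := eqVneq (lorentz x x) 0.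
    rewrite /w q0 scale0r addr0; do 2 apply: soc_scale => //; lra.
  apply: (soc_of_lorentz_gt0 sx).
    have -> : lorentz w w = (2 * f)^-1 ^+ 2 * lorentz x x * ((f - lorentz d x) ^+ 2 +
        2 * (f - lorentz d x) * lorentz d x + lorentz d d * lorentz x x).
      by rewrite /w !lorentz_lin (lorentzC x d); ring.
    rewrite qq; rewrite (_ : _ * _ = 0) //; ring.
  have -> : lorentz w x = lorentz x x / 2 by rewrite /w !lorentz_lin; field.
  by rewrite divr_gt0// lt_neqAle eq_sym qn0.
- have -> : lorentz d y = (2 * f)^-1 * ((f + lorentz d x) * lorentz d x -
      lorentz d d * lorentz x x).
    by rewrite /y !lorentz_lin; ring.
  by rewrite qq; field.
Qed.

(** After squaring, the difference of the two sides is twice the expression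
    of [spacelike_reflection_ge0] plus nonnegative multiples of [lorentz y y] and
    [lorentz w w]. *)
Lemma le_sqrt_radicand d y w : lorentz d d < 0 -> soc y -> soc w ->
  lorentz d y - lorentz d w <=
  Num.sqrt (lorentz d (y + w) ^+ 2 - lorentz d d * lorentz (y + w) (y + w)).
Proof.
move=> dd sy sw; apply: le_trans (ler_norm _) _; rewrite -sqrtr_sqr ler_wsqrtr//.
have := spacelike_reflection_ge0 dd sy sw.
have [_ qy] := (socP y).1 sy; have [_ qw] := (socP w).1 sw.
have dy : 0 <= - lorentz d d * lorentz y y by rewrite mulr_ge0//; lra.
have dw : 0 <= - lorentz d d * lorentz w w by rewrite mulr_ge0//; lra.
rewrite !lorentz_lin (lorentzC w y); lra.
Qed.

(** If [x] is the convex combination of [x1] and [x2], in the cuts by [c1] and by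
    [c2] at level [a], with weights [t] and [1 - t], then [y := t *: x1] is such a
    witness: the two constraints have been summed, so the weights disappear. *)
Definition splits c1 c2 a : set 'cV[R]_n.+1 :=
  [set x | exists y, [/\ soc y, soc (x - y) & a <= dotv c1 y + dotv c2 (x - y)]].

(** With [w := x - y], twice [dotv c1 y + dotv c2 w] is
    [dotv (c1 + c2) x + dotv (c1 - c2) (y - w)]. A witness thus exists exactly when
    the maximum of the last term, which is the square root, reaches
    [2 * a - dotv (c1 + c2) x]. *)
Lemma disj_ineqE c1 c2 a x : 0 < calN c1 c2 -> soc x ->
  disj_ineq c1 c2 a x <-> splits c1 c2 a x.
Proof.
move=> N0 sx; rewrite /disj_ineq.
have dd : lorentz (flip (c1 - c2)) (flip (c1 - c2)) < 0.
  by move: N0; rewrite calN_lorentz oppr_gt0.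
have -> : calN c1 c2 * (lastc x ^+ 2 - norm2 (initv x) ^+ 2) =
   - (lorentz (flip (c1 - c2)) (flip (c1 - c2)) * lorentz x x).
  by rewrite calN_lorentz /lorentz sqr_norm2; ring.
split=> [h|[y [sy sw h]]].
  have [y [sy sw yE]] := null_splitting dd sx.
  move: yE; rewrite -[lorentz _ y]dotv_flip -[lorentz _ x]dotv_flip => yE.
  exists y; split=> //.
  have := lerD (lexx (dotv (c1 - c2) x)) h; rewrite -yE !dotv_lin; lra.
have := le_sqrt_radicand dd sy sw.
rewrite [y + _]addrC subrK -[lorentz _ y]dotv_flip.
rewrite -[lorentz _ (x - y)]dotv_flip -[lorentz _ x]dotv_flip.
apply: le_trans.
by move: h; rewrite !dotv_lin; lra.
Qed.
End Disj.

(** * Closures, convex hulls and continuity *)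

Lemma nbhs_ray (R : realType) (m : nat) (z v : 'cV[R]_m) (B : set 'cV[R]_m) :
  nbhs z B -> exists t, [/\ 0 < t, t < 1 & B (z + t *: v)].
Proof.
move=> zB.
have cvg_ray : z + t *: v @[t --> 0^'+] --> z.
  apply: cvg_at_right_filter; rewrite -[X in _ --> X]addr0 -(scale0r v).
  by apply: cvgD; [exact: cvg_cst|exact: scalel_continuous].
have [t] : exists t, (0 < t /\ t < 1) /\ B (z + t *: v).
  apply: (@filter_ex _ 0^'+).
  apply: filterI; last exact: cvg_ray.
  by apply: filterI; [exact: nbhs_right_gt|exact: nbhs_right_lt].
by move=> [[t0 t1] Bt]; exists t.
Qed.

Section Hull.
Variables (R : realType) (m : nat) (A : set 'cV[R]_m).

Lemma sub_closed_convex_hull : A `<=` closed_convex_hull A.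
Proof.
by move=> x Ax; apply: subset_closure; apply: sub_gen_smallest.
Qed.

Lemma convex_hull_conv x y t : 0 <= t -> t <= 1 -> A x -> A y ->
  convex_hull A (t *: x + (1 - t) *: y).
Proof.
move=> t0 t1 Ax Ay B [cB AB].
pose p : {i01 R} := Itv01 t0 t1.
by have /set_mem := cB x y p (mem_set (AB _ Ax)) (mem_set (AB _ Ay)).
Qed.

End Hull.

Lemma sum_continuous (R : realType) (T : topologicalType) (I : Type)
    (r : seq I) (f : I -> T -> R) :
  (forall i, continuous (f i)) -> continuous (fun x => \sum_(i <- r) f i x).
Proof.
move=> cf x.
by apply: (@cvg_big R _ +%R 0 xpredT (@add_continuous _)) => i _; exact: cf.
Qed.

Section Continuity.
Variables (R : realType) (n : nat).
Implicit Types (c : 'cV[R]_n.+1).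

Lemma dotv_continuous m (c : 'cV[R]_m) : continuous (dotv c).
Proof.
rewrite (_ : dotv c = fun x => \sum_i c i 0 * x i 0); last first.
  by apply/funext => y; exact: dotvE.
apply: sum_continuous => i x; apply: continuousM; first exact: cst_continuous.
exact: coord_continuous.
Qed.

Lemma norm2_initv_continuous : continuous (fun x : 'cV[R]_n.+1 => norm2 (initv x)).
Proof.
move=> x; apply: (@continuous_comp _ _ _ _ (@Num.sqrt R)); last exact: sqrt_continuous.
apply: sum_continuous => i.
rewrite (_ : (fun y => _) = fun y : 'cV[R]_n.+1 => y (lift ord_max i) 0 ^+ 2).
  by move=> y; apply: continuousM; exact: coord_continuous.
by apply/funext => y; rewrite mxE.
Qed.

Lemma closed_soc : closed (@soc R n).
Proof.
rewrite (_ : @soc R n = (fun x => lastc x - norm2 (initv x)) @^-1` [set r | 0 <= r]).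
  apply: preimage_closed; last exact: closed_ge.
  move=> x _; apply: continuousB; first exact: coord_continuous.
  exact: norm2_initv_continuous.
by apply/seteqP; split=> x; rewrite /soc/= subr_ge0.
Qed.

Lemma closed_disj_ineq c1 c2 a : closed (disj_ineq c1 c2 a).
Proof.
pose g x := Num.sqrt (dotv (c1 - c2) x ^+ 2 +
            calN c1 c2 * (lastc x ^+ 2 - norm2 (initv x) ^+ 2)).
rewrite (_ : disj_ineq c1 c2 a =
   (fun x => g x - (2 * a - dotv (c1 + c2) x)) @^-1` [set r | 0 <= r]).
  apply: preimage_closed; last exact: closed_ge.
  move=> x _; apply: continuousB; last first.
    by apply: continuousB; [exact: cst_continuous|exact: dotv_continuous].
  apply: (@continuous_comp _ _ _ _ (@Num.sqrt R)); last exact: sqrt_continuous.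
  apply: continuousD; first by apply: continuousM; exact: dotv_continuous.
  apply: continuousM; first exact: cst_continuous.
  apply: continuousB; apply: continuousM; do ?exact: coord_continuous.
  - exact: norm2_initv_continuous.
  - exact: norm2_initv_continuous.
by apply/seteqP; split=> x; rewrite /disj_ineq/= subr_ge0.
Qed.

End Continuity.

(** * Duality for one linear cut of the cone *)

Section Duality.
Variables (R : realType) (n : nat).
Implicit Types (x y c mu : 'cV[R]_n.+1).

(** An interior point that satisfies the constraint with equality can be moved in
    the direction [c]; properness of the cut excludes [c = 0]. *)
Lemma strictly_feasible c (c0 : R) :
  (cut_soc c c0 `&` interior (@soc R n)) !=set0 -> ~ (@soc R n `<=` cut_soc c c0) ->
  exists2 x, soc x & c0 < dotv c x.
Proof.
move=> [x [[sx cx] ix]] nK.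
have c_neq0 : c != 0.
  apply/eqP => c_eq0; apply: nK => y sy; split=> //.
  by move: cx; rewrite c_eq0 !dotv0l.
have [t [t0 _ st]] := nbhs_ray c ix.
exists (x + t *: c) => //; apply: (le_lt_trans cx).
by rewrite dotvDr dotvZr ltrDl mulr_gt0// dotvv_gt0.
Qed.

(** By homogeneity: a negative value of [mu] at a point would become arbitrarily
    negative along the ray through it. *)
Lemma cone_affine_bound mu (mu0 : R) : (forall x, soc x -> mu0 <= dotv mu x) ->
  soc mu /\ mu0 <= 0.
Proof.
move=> H; split; last by rewrite -(dotv0 mu); apply: H; exact: soc0.
apply: soc_self_dual => x sx; rewrite leNgt; apply/negP => neg.
have t0 : 0 <= (`|mu0| + 1) / - dotv mu x.
  by rewrite divr_ge0 ?addr_ge0// oppr_ge0 ltW.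
have := H _ (soc_scale t0 sx).
rewrite dotvZr invrN mulrN mulNr mulfVK ?lt_eqF//.
by have := ler_norm (- mu0); rewrite normrN; lra.
Qed.

(** The multiplier [b] must satisfy [b * (dotv c x - c0) <= dotv mu x - mu0] on the
    whole cone. Points where the constraint is slack bound [b] from above by the
    ratio of these two quantities, and [b] is the infimum of these bounds. Points
    that violate the constraint bound it from below; each such bound is at most
    each upper bound, because the segment between the two points meets the
    hyperplane [dotv c x = c0], where the inequality is known. *)
Lemma lagrange_duality c mu (c0 mu0 : R) :
  (exists2 x, soc x & c0 < dotv c x) ->
  valid_ineq (cut_soc c c0) (mu, mu0) ->
  exists b, [/\ 0 <= b, soc (mu - b *: c) & mu0 <= b * c0].
Proof.
move=> [x0 sx0 cx0] V.
pose ratio x := (dotv mu x - mu0) / (dotv c x - c0).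
pose E := [set ratio x | x in [set x | soc x /\ c0 < dotv c x]].
have E0 : E !=set0 by exists (ratio x0), x0.
have Elb : lbound E 0.
  move=> _ [x [sx cx] <-]; rewrite divr_ge0 ?subr_ge0 ?(ltW cx)//.
  by apply: V; split=> //; exact: ltW.
pose b := inf E.
have b0 : 0 <= b by exact: lb_le_inf.
have main x : soc x -> mu0 - b * c0 <= dotv (mu - b *: c) x.
  move=> sx; rewrite !dotv_lin.
  suff : b * (dotv c x - c0) <= dotv mu x - mu0 by lra.
  have [lt_c|lt_c|eq_c] := ltgtP c0 (dotv c x).
  - by rewrite -ler_pdivlMr ?subr_gt0//; apply: ge_inf; [exists 0|exists x].
  - rewrite -ler_ndivrMr ?subr_lt0//; apply: lb_le_inf => // _ [y [sy cy] <-].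
    rewrite /ratio ler_pdivlMr ?subr_gt0// mulrAC ler_ndivrMr ?subr_lt0//.
    have cyx : 0 < dotv c y - dotv c x by rewrite subr_gt0 (lt_trans lt_c).
    pose z := (dotv c y - dotv c x)^-1 *:
      ((dotv c y - c0) *: x + (c0 - dotv c x) *: y).
    have /V : cut_soc c c0 z.
      split; first apply: soc_scale; rewrite ?invr_ge0 ?(ltW cyx)//.
        by apply: soc_add; apply: soc_scale => //; lra.
      rewrite /z dotvZr !dotv_lin le_eqVlt; apply/orP; left; apply/eqP.
      by field; lra.
    rewrite /z /= dotvZr ler_pdivlMl// !dotv_lin; lra.
  - by rewrite eq_c subrr mulr0 subr_ge0; apply: V; split; rewrite ?eq_c.
have [s le] := cone_affine_bound main.
by exists b; split=> //; lra.
Qed.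

End Duality.

(** * The hull of two cuts *)

Section Main.
Context {R : realType} {n : nat}.
Implicit Types (x y w p c mu : 'cV[R]_n.+1) (a b : R).

Lemma splits_convex c1 c2 a : @convex_set R 'cV[R]_n.+1 (splits c1 c2 a).
Proof.
move=> x x' t /set_mem[y [sy sw h]] /set_mem[y' [sy' sw' h']]; apply/mem_set.
have t0 : 0 <= t%:num by [].
have t1 : 0 <= 1 - t%:num by rewrite subr_ge0.
exists (t%:num *: y + (1 - t%:num) *: y').
have -> : conv t x x' - (t%:num *: y + (1 - t%:num) *: y') =
    t%:num *: (x - y) + (1 - t%:num) *: (x' - y').
  by rewrite opprD addrACA !scalerBr.
split; do ?[by apply: soc_add; apply: soc_scale].
rewrite !(dotvDr, dotvZr) in h h' *.
have -> : a = t%:num * a + (1 - t%:num) * a by ring.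
by have := lerD (ler_wpM2l t0 h) (ler_wpM2l t1 h'); lra.
Qed.

Lemma cut_socU_splits c1 c2 a a1 : a <= a1 ->
  cut_soc c1 a1 `|` cut_soc c2 a `<=` splits c1 c2 a.
Proof.
move=> aa1 x [[sx cx]|[sx cx]].
  by exists x; rewrite subrr dotv0 addr0; split=> //; [exact: soc0|exact: le_trans cx].
by exists 0; rewrite subr0 dotv0 add0r; split=> //; exact: soc0.
Qed.

Lemma splits_soc c1 c2 a : splits c1 c2 a `<=` @soc R n.
Proof. by move=> x [y [sy sw _]]; rewrite -(subrK y x) addrC; apply: soc_add. Qed.

Lemma closed_convex_hull_splits c1 c2 a a1 : 0 < calN c1 c2 -> a <= a1 ->
  closed_convex_hull (cut_soc c1 a1 `|` cut_soc c2 a) `<=`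
  [set x | soc x /\ disj_ineq c1 c2 a x].
Proof.
move=> N0 aa1.
have /closure_id -> : closed [set x | soc x /\ disj_ineq c1 c2 a x].
  by apply: closedI; [exact: closed_soc|exact: closed_disj_ineq].
apply: closureS => x hx.
have sx : splits c1 c2 a x.
  by apply: (smallest_sub _ _ hx); [exact: splits_convex|exact: cut_socU_splits].
have kx : soc x by exact: splits_soc sx.
by split=> //; apply/disj_ineqE.
Qed.

(** The point [p + y] is the limit for [t] tending to 0 of
    [t *: (x0 + t^-1 *: y) + (1 - t) *: p], where the first point remains in the
    cut since [c1] is nonnegative on the cone. *)
Lemma hull_recession c1 a1 (B : set 'cV[R]_n.+1) x0 p y : soc c1 ->
  cut_soc c1 a1 x0 -> B p -> soc y ->
  closed_convex_hull (cut_soc c1 a1 `|` B) (p + y).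
Proof.
move=> sc [sx0 cx0] Bp sy U /(nbhs_ray (x0 - p))[t [t0 t1 Ut]].
exists (p + y + t *: (x0 - p)); split => //.
have -> : p + y + t *: (x0 - p) = t *: (x0 + t^-1 *: y) + (1 - t) *: p.
  by apply/matrixP => i j; rewrite !mxE; field; rewrite gt_eqF.
apply: convex_hull_conv; rewrite ?ltW//; last by right.
left; split; first by apply: soc_add => //; apply: soc_scale => //; rewrite invr_ge0 ltW.
by rewrite dotvDr ler_wpDr// dotvZr mulr_ge0 ?soc_dotv// invr_ge0 ltW.
Qed.

(** The number [dotv c1 y], which is nonnegative as [c1] is in the cone, serves as
    the weight of the first cut. If it is at least 1, the whole sum is in the
    first cut; if it vanishes, [y] is only a recession direction. *)
Lemma split_in_hull c1 c2 x0 y w : soc c1 -> cut_soc c1 1 x0 ->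
  soc y -> soc w -> 1 <= dotv c1 y + dotv c2 w ->
  closed_convex_hull (cut_soc c1 1 `|` cut_soc c2 1) (y + w).
Proof.
move=> sc hx0 sy sw h.
have cy : 0 <= dotv c1 y := soc_dotv sc sy.
have cw : 0 <= dotv c1 w := soc_dotv sc sw.
have [l1|l1] := leP 1 (dotv c1 y).
  apply: sub_closed_convex_hull; left; split; first exact: soc_add.
  by rewrite dotvDr ler_wpDr.
have [l0|l0] := eqVneq (dotv c1 y) 0.
  rewrite addrC; apply: hull_recession hx0 _ sy => //; split=> //.
  by rewrite l0 add0r in h.
have lp : 0 < dotv c1 y by rewrite lt_neqAle eq_sym l0.
have -> : y + w = dotv c1 y *: ((dotv c1 y)^-1 *: y) +
    (1 - dotv c1 y) *: ((1 - dotv c1 y)^-1 *: w).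
  by rewrite !scalerA !divff ?scale1r// subr_eq0 gt_eqF.
have i1 : 0 < 1 - dotv c1 y by rewrite subr_gt0.
apply: subset_closure; apply: convex_hull_conv; rewrite ?ltW//.
  by left; split; [apply: soc_scale => //; rewrite invr_ge0 ltW|rewrite dotvZr mulVf].
right; split; first by apply: soc_scale => //; rewrite invr_ge0 ltW.
by rewrite dotvZr mulrC ler_pdivlMr// mul1r; lra.
Qed.

Lemma soc_cut_le0 c a : soc c -> a <= 0 -> @soc R n `<=` cut_soc c a.
Proof. by move=> sc a0 x sx; split=> //; rewrite (le_trans a0)// soc_dotv. Qed.

(** Weak duality: [b * a] is itself a lower bound of [dotv mu] on the cut, so it
    cannot exceed the infimum. *)
Lemma tight_multiplier c mu a (mu0 : R) :
  (cut_soc c a `&` interior (@soc R n)) !=set0 -> ~ (@soc R n `<=` cut_soc c a) ->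
  valid_ineq (cut_soc c a) (mu, mu0) -> tight_on (cut_soc c a) (mu, mu0) ->
  exists b, [/\ 0 <= b, soc (mu - b *: c) & mu0 = b * a].
Proof.
move=> hi hK V T.
have [b [b0 s le]] := lagrange_duality (strictly_feasible hi hK) V.
exists b; split=> //; apply/eqP; rewrite eq_le le/= -lee_fin -[X in (_ <= X)%E]T.
apply: le_ereal_inf_tmp => _ [x [sx cx] <-] /=; rewrite lee_fin.
have := soc_dotv s sx; have := ler_wpM2l b0 cx.
by rewrite !dotv_lin; lra.
Qed.

Lemma cut_soc_proper c c' a a' : ~ (cut_soc c' a' `<=` cut_soc c a) ->
  ~ (@soc R n `<=` cut_soc c a).
Proof. by move=> h k; apply: h => x [sx _]; exact: k. Qed.

End Main.

End Proof.

Theorem theorem2 (R : realType) (n : nat) (c1 c2 : 'cV[R]_n.+1) (c10 c20 : R)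
  (hc10 : c10 \in [:: 0; 1; -1]) (hc20 : c20 \in [:: 0; 1; -1])
  (hc : c20 <= c10)
  (h12 : ~ (cut_soc c1 c10 `<=` cut_soc c2 c20))
  (h21 : ~ (cut_soc c2 c20 `<=` cut_soc c1 c10))
  (hint1 : cut_soc c1 c10 `&` interior (@soc R n) !=set0)
  (hint2 : cut_soc c2 c20 `&` interior (@soc R n) !=set0)
  (hpos : ~ (@soc R n) (c1 - c2))
  (hneg : ~ ((fun x => - x) @` @soc R n) (c1 - c2)) :
  (forall x, closed_convex_hull (cut_soc c1 c10 `|` cut_soc c2 c20) x ->
     disj_ineq c1 c2 c20 x) /\
  ((soc c1 \/ soc c2) \/
   [/\ c10 = c20, c10 = 1 \/ c10 = -1 &
       sufficient
         [set p | [/\ undominated (closed_convex_hull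
                                     (cut_soc c1 c10 `|` cut_soc c2 c20)) p,
                      tight_on (cut_soc c1 c10) p &
                      tight_on (cut_soc c2 c20) p]]
         (closed_convex_hull (cut_soc c1 c10 `|` cut_soc c2 c20))] ->
   closed_convex_hull (cut_soc c1 c10 `|` cut_soc c2 c20) =
     [set x | soc x /\ disj_ineq c1 c2 c20 x]).
Proof.
have N0 := calN_gt0 hpos hneg.
have sub := closed_convex_hull_splits N0 hc.
have nK1 := cut_soc_proper h21; have nK2 := cut_soc_proper h12.
split=> [x /sub[]//|cond]; apply/seteqP; split=> // x [sx /(disj_ineqE _ N0 sx)].
move=> [y [sy sw h]]; rewrite -(subrK y x) addrC; move: (x - y) sw h => w sw h.
(* A cut by a vector of the cone at level 0 or -1 would be the whole cone. *)
have pos (c : 'cV[R]_n.+1) (a : R) : a \in [:: 0; 1; -1] -> soc c ->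
    ~ (@soc R n `<=` cut_soc c a) -> a = 1.
  by rewrite !inE => /or3P[]/eqP-> // sc []; apply: soc_cut_le0.
have [x1 [C1x1 _]] := hint1; have [x2 [C2x2 _]] := hint2.
case: cond => [[sc1|sc2]|[cE c1E suf]].
- have c10E : c10 = 1 by apply: pos nK1.
  have [c20E|c20n] := eqVneq c20 1.
    by subst; exact: split_in_hull C1x1 _ _ _.
  (* The level of the second cut is 0 or -1, so it contains the origin. *)
  rewrite -[y + w]add0r; apply: hull_recession C1x1 _ _ => //; last exact: soc_add.
  split; first exact: soc0.
  rewrite dotv0; move: hc20 c20n.
  by rewrite !inE => /or3P[]/eqP->; rewrite ?eqxx// oppr_le0.
- have c20E : c20 = 1 by apply: pos nK2.
  have c10E : c10 = 1.
    move: hc10 hc; rewrite c20E !inE => /or3P[]/eqP-> //; lra.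
  subst; rewrite setUC addrC; apply: split_in_hull C2x2 _ _ _ => //.
  by rewrite addrC.
- subst c10; rewrite suf; split; first exact: soc_add.
  move=> [mu mu0] [[V _ _] T1 T2] /=.
  have V1 : valid_ineq (cut_soc c1 c20) (mu, mu0).
    by move=> z Cz; apply: V; apply: sub_closed_convex_hull; left.
  have V2 : valid_ineq (cut_soc c2 c20) (mu, mu0).
    by move=> z Cz; apply: V; apply: sub_closed_convex_hull; right.
  have [b [b0 s1 e1]] := tight_multiplier hint1 nK1 V1 T1.
  have [b' [_ s2 e2]] := tight_multiplier hint2 nK2 V2 T2.
  have bb : b' = b.
    by move: e2; rewrite e1; case: c1E => ->; lra.
  have := soc_dotv s1 sy; have := soc_dotv s2 sw; have := ler_wpM2l b0 h.
  by rewrite e1 bb !dotv_lin; lra.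
Qed.
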